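(* Let $E\neq\{0\}$ be a real Banach space, let $F$ be a real Hilbert space, let $\varepsilon\ge0$, and let $f\colon E\to F$ be an $\varepsilon$-nearisometry such that $f(0)=0$ and $\tau(fE)<1$. Then there is a surjective linear isometry $T\colon E\to F$ with $\sup\{|T(x)-f(x)|:x\in E\}\le2\varepsilon$.
   Context: Norms are denoted $|\cdot|$. For $\varepsilon\ge0$, a map $f\colon E\to F$ is an $\varepsilon$-nearisometry if $|x-y|-\varepsilon\le|f(x)-f(y)|\le|x-y|+\varepsilon$ for all $x,y\in E$. $fE$ denotes the image of $f$. For an unbounded subset $B$ of a Hilbert space $F$, set \[ \tau(B)=\sup_{e\in F,\,|e|=1}\ \liminf_{|t|\to\infty}\frac{d(te,B)}{|t|}, \] where $t$ ranges over $\mathbb{R}$ and $d(y,B)$ is the distance from the point $y$ to the set $B$. *)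

(* Defs.v *)
From HB Require Import structures.
From mathcomp Require Import all_boot all_order all_algebra.
From mathcomp Require Import all_classical all_reals all_analysis.

Set Implicit Arguments.
Unset Strict Implicit.
Unset Printing Implicit Defensive.

Import Order.TTheory GRing.Theory Num.Theory.
Import numFieldNormedType.Exports.

Local Open Scope classical_set_scope.
Local Open Scope ring_scope.

Definition nearisometry (R : realType) (E F : normedModType R) (eps : R)
    (f : E -> F) : Prop :=
  forall x y : E,
    `|x - y| - eps <= `|f x - f y| /\ `|f x - f y| <= `|x - y| + eps.

(* The filter on R of "|t| -> oo": t may tend to +oo or to -oo. *)
Definition norm_infty_nbhs (R : realType) : set_system R :=
  filter_from [set: R] (fun M : R => [set t | M < `|t|]).

(* Defined for every B, but only meant for unbounded B. On a normed module,
   edist is the distance |x - y|, so edist_inf B y is d(y, B). *)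
Definition tau (R : realType) (F : normedModType R) (B : set F) : \bar R :=
  ereal_sup [set limf_einf (fun t : R => edist_inf B (t *: e) / `|t|%:E)%E
                           (@norm_infty_nbhs R)
            | e in [set e : F | `|e| = 1]].

(* The norm is the one of the inner product; together with norm completeness
   this makes F a real Hilbert space. *)
Definition norm_from_dot (R : realType) (F : normedModType R)
    (dot : {dot F for (@idfun R)}) : Prop :=
  forall x : F, `|x| ^+ 2 = dot x x.

(* Main.v *)
Require Import Defs.
From HB Require Import structures.
From mathcomp Require Import all_boot all_order all_algebra.
From mathcomp Require Import all_classical all_reals all_analysis.
From mathcomp Require Import ring lra.

Set Implicit Arguments.
Unset Strict Implicit.
Unset Printing Implicit Defensive.

Import Order.TTheory GRing.Theory Num.Theory.
Import numFieldNormedType.Exports.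

Local Open Scope classical_set_scope.
Local Open Scope ring_scope.

(** A near-isometry differs from an isometry by a bounded error, which scaling
    down makes vanish: the maps [x |-> f (s x) / s] become isometric as [s]
    grows.  Expanding [|f (s x) / s - f (t x) / t|^2] by the inner product of
    [F], the main terms cancel and at most [8 eps (|x| + eps) / s] is left for
    [1 <= s <= t] ([rescaling_rate]).  Hence the rescaled maps converge to an
    isometry [T] with [T 0 = 0], and [s = 1] gives
    [|f x - T x|^2 <= 8 eps (|x| + eps)]: the deviation of [f] from [T] is
    sublinear ([linear_rescaled_limit]).

    Such a [T] is linear, although [E] is only a Banach space: the
    quadrilateral inequality of [F] pulls back along [T] to the parallelogram
    law in [E], and the parallelogram law is what additivity of [T] amounts to
    once [|T (x + y) - T x - T y|^2] is expanded ([isometry_linear]).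

    If [T] missed a point, Riesz's lemma, applied to the closed range of [T],
    would give unit vectors [e] whose multiples [t e] stay at distance at least
    [(1 - d) |t|] from the range of [T].  As [f] deviates sublinearly from [T],
    they stay at distance [(1 - 2 d) |t|] from the range of [f] for large [t],
    so [tau (range f)] would be at least [1] ([surjective_of_tau_lt1]).

    For the constant [2 eps], compare the distances from the far point
    [f (s u)] to [f x] and to [f 0 = 0].  Each determines its counterpart in
    [E] up to [eps], and as [s] grows their difference tends to the component
    of [f x] in the direction [T u].  Thus [f x - T x] has component at most
    [2 eps] in each direction [T u] ([dot_deviation]); when [T] is surjective,
    its own direction is among these ([deviation_of_surjective]). *)

(** * Inner products and isometries into an inner product space *)

Section Hilbert.
Context (R : realType) (F : normedModType R) (dot : {dot F for (@idfun R)}).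
Hypothesis dotE : norm_from_dot dot.

Lemma dot_sym u v : dot u v = dot v u.
Proof. by rewrite hermC mul1r. Qed.

Lemma dot_addl u v w : dot (u + v) w = dot u w + dot v w.
Proof. exact: linearDl. Qed.

Lemma dot_scalel a u v : dot (a *: u) v = a * dot u v.
Proof. exact: linearZl_LR. Qed.

Lemma dot_addr u v w : dot u (v + w) = dot u v + dot u w.
Proof. by rewrite dot_sym dot_addl !(dot_sym u). Qed.

Lemma dot_scaler a u v : dot u (a *: v) = a * dot u v.
Proof. by rewrite dot_sym dot_scalel dot_sym. Qed.

Lemma dot_oppr u v : dot u (- v) = - dot u v.
Proof. by rewrite -scaleN1r dot_scaler mulN1r. Qed.

Lemma norm_subE u v : `|u - v| ^+ 2 = `|u| ^+ 2 + `|v| ^+ 2 - 2 * dot u v.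
Proof.
rewrite !dotE dot_addl !dot_addr !dot_oppr !(dot_sym (- v)) !dot_oppr.
ring.
Qed.

Lemma norm_addE u v : `|u + v| ^+ 2 = `|u| ^+ 2 + `|v| ^+ 2 + 2 * dot u v.
Proof. rewrite !dotE dot_addl !dot_addr (dot_sym v u); ring. Qed.

(** The quadrilateral [0, b, c, d] has diagonals [c] and [b - d]; the defect is
    [|b + d - c|^2].  Only distances between four points occur, so the
    inequality passes to every space that embeds isometrically. *)
Lemma quadrilateral (b c d : F) :
  `|c| ^+ 2 + `|b - d| ^+ 2
    <= `|b| ^+ 2 + `|b - c| ^+ 2 + `|d - c| ^+ 2 + `|d| ^+ 2.
Proof.
have := sqr_ge0 (`|b + d - c|); rewrite norm_subE norm_addE dot_addl.
rewrite !norm_subE; lra.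
Qed.

(** Since [2 dot (T x) (T y)] equals [|x|^2 + |y|^2 - |x - y|^2], the squared
    defects of additivity and of homogeneity are expressions in norms of [E].
    The second vanishes identically, the first by the parallelogram law. *)
Lemma isometry_linear (E : normedModType R) (T : E -> F) :
  (forall x y, `|T x - T y| = `|x - y|) -> T 0 = 0 -> linear T.
Proof.
move=> Tiso T0.
have Tn x : `|T x| = `|x| by rewrite -[T x]subr0 -T0 Tiso subr0.
have Td x y : 2 * dot (T x) (T y) = `|x| ^+ 2 + `|y| ^+ 2 - `|x - y| ^+ 2.
  by rewrite -Tiso norm_subE !Tn; ring.
have par (x y : E) : `|x + y| ^+ 2 + `|x - y| ^+ 2 <= 2 * `|x| ^+ 2 + 2 * `|y| ^+ 2.
  have := quadrilateral (T x) (T (x + y)) (T y).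
  have -> : `|T x - T (x + y)| = `|y| by rewrite distrC Tiso addrAC subrr add0r.
  have -> : `|T y - T (x + y)| = `|x| by rewrite distrC Tiso addrK.
  by rewrite Tiso !Tn; lra.
(* The reverse inequality is [par] for the diagonals [x + y] and [x - y]. *)
have par2 (x y : E) : 2 * `|x| ^+ 2 + 2 * `|y| ^+ 2 <= `|x + y| ^+ 2 + `|x - y| ^+ 2.
  have ex : x + y + (x - y) = 2%:R *: x.
    by rewrite addrACA subrr addr0 scaler_nat mulr2n.
  have ey : x + y - (x - y) = 2%:R *: y.
    by rewrite opprB addrC addrA subrK scaler_nat mulr2n.
  have := par (x + y) (x - y).
  by rewrite ex ey !normrZ !exprMn ger0_norm //; lra.
have TD x y : T (x + y) = T x + T y.
  apply/subr0_eq/eqP; rewrite -(normr_eq0 (T _ - _)) -sqrf_eq0 eq_le sqr_ge0 andbT.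
  have := Td (x + y) x; have := Td (x + y) y; have := Td x y.
  have -> : x + y - x = y by rewrite addrAC subrr add0r.
  have := par2 x y; rewrite addrK.
  by rewrite norm_subE norm_addE dot_addr !Tn; lra.
have TZ a x : T (a *: x) = a *: T x.
  apply/subr0_eq/eqP; rewrite -(normr_eq0 (T _ - _)) -sqrf_eq0 norm_subE dot_scaler.
  have e : a *: x - x = (a - 1) *: x by rewrite scalerBl scale1r.
  have := Td (a *: x) x; rewrite e.
  rewrite !(Tn, normrZ) !exprMn !real_normK ?num_real// => h; apply/eqP.
  have := congr1 ( *%R a) h; lra.
by move=> a x y; rewrite TD TZ.
Qed.

End Hilbert.

(** * Rescalings of a near-isometry *)

Lemma cvg_of_rate (R : realType) (V : completeNormedModType R) (u : nat -> V)
    (K : R) :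
  0 <= K ->
  (forall m n, (m <= n)%N -> `|u m - u n| ^+ 2 <= K / m.+1%:R) ->
  exists2 l : V, u @ \oo --> l & forall m, `|u m - l| ^+ 2 <= K / m.+1%:R.
Proof.
move=> K0 uK.
have /cauchy_cvgP/cvg_ex [l ul] : cauchy (u @ \oo).
  apply: cauchy_exP => e e0.
  pose m := Num.bound (K / e ^+ 2).
  have e20 : 0 < e ^+ 2 by rewrite exprn_gt0.
  have Km : K / m.+1%:R < e ^+ 2.
    rewrite ltr_pdivrMr// mulrC -ltr_pdivrMr//.
    apply: lt_trans (archi_boundP _) _; first by rewrite divr_ge0// ltW.
    by rewrite ltr_nat.
  exists (u m); exists m => // n /= mn; rewrite -ball_normE /=.
  rewrite -(ltr_pXn2r (n := 2)) ?nnegrE// ?(ltW e0)//.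
  exact: le_lt_trans (uK _ _ mn) Km.
exists l => // m.
have cv : (fun n => `|u m - u n| ^+ 2) @ \oo --> `|u m - l| ^+ 2.
  have cn : (fun n => `|u m - u n|) @ \oo --> `|u m - l|.
    by apply: cvg_norm; apply: cvgB ul; exact: cvg_cst.
  by rewrite expr2; under eq_fun do rewrite expr2; apply: cvgM.
rewrite -(cvg_lim _ cv)//; apply: limr_le; first by apply/cvg_ex; eexists; exact: cv.
by exists m => // n /= mn; exact: uK.
Qed.

(** Squaring [r - e <= a] would give this with [e^2] added on the left, but only
    for [e <= r]; without that term the left side is nonpositive when [r < e]. *)
Lemma sqr_lower_bound (R : realFieldType) (e r a : R) :
  0 <= e -> 0 <= r -> 0 <= a -> r - e <= a -> r ^+ 2 - 2 * e * r <= a ^+ 2.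
Proof. by move=> e0 r0 a0 ra; case: (lerP r e) => re; nra. Qed.

Section Nearisometry.
Context (R : realType) (E : normedModType R) (F : completeNormedModType R).
Context (dot : {dot F for (@idfun R)}) (dotE : norm_from_dot dot).
Context (eps : R) (eps_ge0 : 0 <= eps) (f : E -> F).
Context (f_near : nearisometry eps f) (f0 : f 0 = 0).

Lemma near_norm x : `|x| - eps <= `|f x| /\ `|f x| <= `|x| + eps.
Proof. by have := f_near x 0; rewrite f0 !subr0. Qed.

(** With [A := f (s x)] and [B := f (t x)], the upper bounds on [|A|] and [|B|]
    are combined with a lower bound on [dot A B], which comes from the lower
    bounds on [|A|] and [|B|] and the upper bound on [|B - A|].  All terms free
    of [eps] cancel, because [0], [s x] and [t x] are collinear. *)
Lemma rescaling_rate (s t : R) (x : E) : 1 <= s -> s <= t ->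
  `|s^-1 *: f (s *: x) - t^-1 *: f (t *: x)| ^+ 2 <= 8 * eps * (`|x| + eps) / s.
Proof.
move=> s1 st; have s0 : 0 < s by lra.
have t0 : 0 < t by lra.
have [Al Au] := near_norm (s *: x); have [Bl Bu] := near_norm (t *: x).
have [_ ABu] := f_near (t *: x) (s *: x).
move: Al Au Bl Bu ABu.
rewrite -scalerBl !normrZ !ger0_norm; [|lra|lra|lra].
set r := `|x|; set A := f (s *: x); set B := f (t *: x) => Al Au Bl Bu ABu.
have r0 : 0 <= r by exact: normr_ge0.
have nA := normr_ge0 A; have nB := normr_ge0 B; have nBA := normr_ge0 (B - A).
have ABE := norm_subE dotE B A; rewrite (dot_sym dot) in ABE.
rewrite (norm_subE dotE) !normrZ dot_scalel dot_scaler.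
rewrite !ger0_norm ?invr_ge0//; [|lra|lra].
have A2 : `|A| ^+ 2 >= (s * r) ^+ 2 - 2 * eps * (s * r).
  by apply: sqr_lower_bound => //; rewrite mulr_ge0// ltW.
have B2 : `|B| ^+ 2 >= (t * r) ^+ 2 - 2 * eps * (t * r).
  by apply: sqr_lower_bound => //; rewrite mulr_ge0// ltW.
have AB2 : `|B - A| ^+ 2 <= ((t - s) * r + eps) ^+ 2.
  by rewrite ler_pXn2r// nnegrE; lra.
have dAB : 2 * dot A B >= 2 * s * t * r ^+ 2 - 4 * eps * t * r - eps ^+ 2.
  by rewrite ABE in AB2; lra.
set a := s^-1; set b := t^-1.
have a0 : 0 < a by rewrite invr_gt0.
have b0 : 0 < b by rewrite invr_gt0.
have sa : s * a = 1 by rewrite mulfV// gt_eqF.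
have tb : t * b = 1 by rewrite mulfV// gt_eqF.
have ba : b <= a by rewrite lef_pV2.
have a1 : a <= 1 by rewrite invf_le1.
have h1 : (a * `|A|) ^+ 2 <= (r + eps * a) ^+ 2.
  have : a * `|A| <= r + eps * a.
    rewrite (_ : r = a * (s * r)); last by rewrite mulrA (mulrC a) sa mul1r.
    by rewrite (mulrC eps) -mulrDr ler_pM2l.
  by move=> h; rewrite ler_pXn2r// nnegrE; nra.
have h2 : (b * `|B|) ^+ 2 <= (r + eps * b) ^+ 2.
  have : b * `|B| <= r + eps * b.
    rewrite (_ : r = b * (t * r)); last by rewrite mulrA (mulrC b) tb mul1r.
    by rewrite (mulrC eps) -mulrDr ler_pM2l.
  by move=> h; rewrite ler_pXn2r// nnegrE; nra.
have h3 : 2 * (a * (b * dot A B)) >= 2 * r ^+ 2 - 4 * eps * r * a - eps ^+ 2 * a * b.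
  rewrite [X in X <= _](_ : _ =
    a * b * (2 * s * t * r ^+ 2 - 4 * eps * t * r - eps ^+ 2)); last first.
    transitivity (2 * (s * a) * (t * b) * r ^+ 2 - 4 * eps * r * a * (t * b)
      - eps ^+ 2 * a * b); last by ring.
    by rewrite sa tb; ring.
  rewrite [X in _ <= X](_ : _ = a * b * (2 * dot A B)); last by ring.
  by rewrite ler_pM2l// mulr_gt0.
have h4 : eps * r * b <= eps * r * a by rewrite ler_wpM2l// mulr_ge0.
have h5 : eps ^+ 2 * (a * a) <= eps ^+ 2 * a.
  by rewrite ler_wpM2l ?sqr_ge0// ler_piMr// ltW.
have h6 : eps ^+ 2 * (b * b) <= eps ^+ 2 * a.
  by rewrite ler_wpM2l ?sqr_ge0//; nra.
have h7 : eps ^+ 2 * (a * b) <= eps ^+ 2 * a.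
  by rewrite ler_wpM2l ?sqr_ge0//; nra.
have h8 : 0 <= eps ^+ 2 * a by rewrite mulr_ge0 ?sqr_ge0// ltW.
by move: h1 h2 h3 h4 h5 h6 h7 h8; lra.
Qed.

End Nearisometry.

(** * The linear isometry at infinity *)

Section ScalingLimit.
Context (R : realType) (E : normedModType R) (F : completeNormedModType R).
Context (dot : {dot F for (@idfun R)}) (dotE : norm_from_dot dot).
Context (eps : R) (eps_ge0 : 0 <= eps) (f : E -> F).
Context (f_near : nearisometry eps f) (f0 : f 0 = 0).

(** The scale is [n + 1], so that the sequence starts at [f] itself. *)
Definition rescaled (n : nat) (x : E) : F := n.+1%:R^-1 *: f (n.+1%:R *: x).

Lemma rescaled_dist n (x y : E) :
  `|x - y| - eps * harmonic n <= `|rescaled n x - rescaled n y|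
    <= `|x - y| + eps * harmonic n.
Proof.
have [l u] := f_near (n.+1%:R *: x) (n.+1%:R *: y); move: l u.
rewrite -scalerBr normrZ ger0_norm// -scalerBr normrZ ger0_norm ?invr_ge0// => l u.
have -> : `|x - y| = n.+1%:R^-1 * (n.+1%:R * `|x - y|) by rewrite mulKf.
rewrite /harmonic /= (mulrC eps) -mulrBr -mulrDr !ler_pM2l ?invr_gt0//.
by rewrite l u.
Qed.

Lemma rescaled_limit : exists T : E -> F,
  (forall x, (fun n => rescaled n x) @ \oo --> T x) /\
  (forall x, `|f x - T x| ^+ 2 <= 8 * eps * (`|x| + eps)).
Proof.
have lims x : exists l : F, (fun n => rescaled n x) @ \oo --> l /\
    `|f x - l| ^+ 2 <= 8 * eps * (`|x| + eps).
  have K0 : 0 <= 8 * eps * (`|x| + eps) by rewrite !mulr_ge0// addr_ge0.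
  have [|l cl rl] := cvg_of_rate (u := fun n => rescaled n x) K0.
    move=> m n mn; apply: (rescaling_rate dotE) => //.
      by rewrite -[1]/(1%:R) ler_nat.
    by rewrite ler_nat.
  exists l; split=> //; have := rl 0%N.
  by rewrite /rescaled mulr1n invr1 mulr1 !scale1r.
have [T TP] := choice lims.
by exists T; split => x; have [] := TP x.
Qed.

Lemma rescaled_limit_isometry (T : E -> F) :
  (forall x, (fun n => rescaled n x) @ \oo --> T x) ->
  forall x y, `|T x - T y| = `|x - y|.
Proof.
move=> Tlim x y.
have c1 : (fun n => `|rescaled n x - rescaled n y|) @ \oo --> `|T x - T y|.
  by apply: cvg_norm; apply: cvgB.
have ch : (fun n => eps * harmonic n) @ \oo --> (0 : R).
  by rewrite -(mulr0 eps); apply: cvgM; [exact: cvg_cst | exact: cvg_harmonic].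
have c2 : (fun n => `|rescaled n x - rescaled n y|) @ \oo --> `|x - y|.
  apply: (@squeeze_cvgr _ _ _ _ (fun n => `|x - y| - eps * harmonic n)
    (fun n => `|x - y| + eps * harmonic n)).
  - by apply: nearW => n; exact: rescaled_dist.
  - by rewrite -[X in _ --> X]subr0; apply: cvgB ch; exact: cvg_cst.
  - by rewrite -[X in _ --> X]addr0; apply: cvgD ch; exact: cvg_cst.
exact: cvg_unique c1 c2.
Qed.

Lemma linear_rescaled_limit : exists T : {linear E -> F},
  [/\ forall x y, `|T x - T y| = `|x - y|,
      forall x, (fun n => rescaled n x) @ \oo --> T x &
      forall x, `|f x - T x| ^+ 2 <= 8 * eps * (`|x| + eps)].
Proof.
have [T [Tlim Trate]] := rescaled_limit.
have Tiso := rescaled_limit_isometry Tlim.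
have T0 : T 0 = 0.
  have := Tlim 0; rewrite /rescaled.
  under eq_fun do rewrite scaler0 f0 scaler0.
  by move=> /(cvg_unique _ (cvg_cst 0)) <-.
have Tlin := isometry_linear dotE Tiso T0.
pose Tl : {linear E -> F} := HB.pack T (GRing.isLinear.Build R E F _ T Tlin).
by exists Tl; split.
Qed.

Lemma norm_linear_isometry (T : {linear E -> F}) :
  (forall x y, `|T x - T y| = `|x - y|) -> forall x, `|T x| = `|x|.
Proof. by move=> Tiso x; rewrite -[T x]subr0 -(linear0 T) Tiso subr0. Qed.

(** By polarization, [2 dot (f x) (f (s u))] is
    [|f x|^2 + |f (s u)|^2 - |f x - f (s u)|^2]; the last two terms are known
    from [|s u|] and [|x - s u|] up to an error [4 eps s + O(1)].  Dividing by
    [s] and letting [s] tend to infinity gives the bound. *)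
Lemma dot_deviation (T : {linear E -> F}) :
  (forall x y, `|T x - T y| = `|x - y|) ->
  (forall x, (fun n => rescaled n x) @ \oo --> T x) ->
  forall x u, `|u| = 1 -> dot (f x - T x) (T u) <= 2 * eps.
Proof.
move=> Tiso Tlim x u u1; have Tn := norm_linear_isometry Tiso.
pose K := `|f x| ^+ 2 + eps ^+ 2 + 2 * eps * `|x|.
have bound n : `|f x| ^+ 2 + `|rescaled n u| ^+ 2 - `|f x - rescaled n u| ^+ 2
    <= 4 * eps + 2 * dot (T x) (T u) + K * harmonic n.
  rewrite (norm_subE dotE) opprB addrCA subrr addr0 dot_scaler /harmonic /=.
  move: (n.+1%:R : R) (ltr0Sn R n) => s s0.
  set A := f (s *: u).
  have [_ Au] := near_norm f_near f0 (s *: u).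
  have [l _] := f_near x (s *: u).
  have m2 : `|x - s *: u| ^+ 2 = `|x| ^+ 2 + s ^+ 2 - 2 * s * dot (T x) (T u).
    rewrite -Tiso linearZ /= (norm_subE dotE) dot_scaler normrZ !Tn u1 mulr1.
    by rewrite ger0_norm ?(ltW s0)//; ring.
  have mle : `|x - s *: u| <= `|x| + s.
    apply: le_trans (ler_normB _ _) _.
    by rewrite normrZ u1 mulr1 ger0_norm ?(ltW s0).
  rewrite -/A in Au l; rewrite normrZ u1 mulr1 ger0_norm ?(ltW s0)// in Au.
  have A2 : `|A| ^+ 2 <= (s + eps) ^+ 2.
    by rewrite ler_pXn2r// nnegrE ?normr_ge0// addr_ge0// ltW.
  have B2 := sqr_lower_bound eps_ge0 (normr_ge0 _) (normr_ge0 _) l.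
  rewrite (norm_subE dotE (f x) A) m2 in B2.
  have em := ler_wpM2l eps_ge0 mle.
  have key : 2 * dot (f x) A <= (4 * eps + 2 * dot (T x) (T u)) * s + K.
    have x20 : 0 <= `|x| ^+ 2 by exact: sqr_ge0.
    by rewrite /K; lra.
  rewrite [X in X <= _](_ : _ = s^-1 * (2 * dot (f x) A)); last by ring.
  rewrite ler_pdivrMl// mulrDr [X in _ <= _ + X]mulrC mulfVK ?gt_eqF//.
  by rewrite [X in _ <= X + _]mulrC.
have cl : (fun n => `|f x| ^+ 2 + `|rescaled n u| ^+ 2
    - `|f x - rescaled n u| ^+ 2) @ \oo -->
    `|f x| ^+ 2 + `|T u| ^+ 2 - `|f x - T u| ^+ 2.
  have sq (v : nat -> F) (w : F) : v @ \oo --> w ->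
      (fun n => `|v n| ^+ 2) @ \oo --> `|w| ^+ 2.
    move=> vw; rewrite expr2; under eq_fun do rewrite expr2.
    by apply: cvgM; apply: cvg_norm.
  apply: cvgB; first by apply: cvgD; [exact: cvg_cst | exact: sq].
  by apply: sq; apply: cvgB => //; exact: cvg_cst.
have cr : (fun n => 4 * eps + 2 * dot (T x) (T u) + K * harmonic n) @ \oo -->
    4 * eps + 2 * dot (T x) (T u).
  rewrite -[X in _ --> X]addr0; apply: cvgD; first exact: cvg_cst.
  by rewrite -(mulr0 K); apply: cvgM; [exact: cvg_cst | exact: cvg_harmonic].
have : `|f x| ^+ 2 + `|T u| ^+ 2 - `|f x - T u| ^+ 2 <=
    4 * eps + 2 * dot (T x) (T u).
  by apply: ler_cvg_to cl cr _; exact: nearW bound.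
rewrite (norm_subE dotE) opprB addrCA subrr addr0 (dot_sym dot (_ - _)).
by rewrite dot_addr dot_oppr !(dot_sym dot (T u)); lra.
Qed.

Lemma deviation_of_surjective (T : {linear E -> F}) :
  (forall x y, `|T x - T y| = `|x - y|) ->
  (forall x, (fun n => rescaled n x) @ \oo --> T x) ->
  (forall z, exists x, T x = z) ->
  forall x, `|T x - f x| <= 2 * eps.
Proof.
move=> Tiso Tlim Tsurj x; have Tn := norm_linear_isometry Tiso.
rewrite distrC; have [->|d0] := eqVneq (f x - T x) 0.
  by rewrite normr0 mulr_ge0.
have [v vE] := Tsurj (f x - T x).
have n0 : 0 < `|f x - T x| by rewrite normr_gt0.
have := dot_deviation Tiso Tlim x (u := `|f x - T x|^-1 *: v).
rewrite linearZ /= vE dot_scaler -dotE normrZ -(Tn v) vE.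
rewrite ger0_norm ?invr_ge0// mulVf ?gt_eqF// => /(_ erefl).
by rewrite expr2 mulKf// gt_eqF.
Qed.

End ScalingLimit.

(** * Surjectivity *)

Section Range.
Context (R : realType) (E : completeNormedModType R) (F : normedModType R).
Context (T : {linear E -> F}) (Tiso : forall x y, `|T x - T y| = `|x - y|).

Lemma isometry_range_closed (z : F) :
  (forall d, 0 < d -> exists x, `|z - T x| < d) -> exists x, T x = z.
Proof.
move=> near_z.
have near_n (n : nat) : exists x, `|z - T x| < n.+1%:R^-1.
  by apply: near_z; rewrite invr_gt0.
have [u uP] := choice near_n.
have rate m n : (m <= n)%N -> `|u m - u n| ^+ 2 <= 4 / m.+1%:R.
  move=> mn; have m0 : 0 < m.+1%:R^-1 :> R by rewrite invr_gt0.
  have m1 : m.+1%:R^-1 <= 1 :> R by rewrite invf_le1// -[1]/(1%:R) ler_nat.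
  have nm : n.+1%:R^-1 <= m.+1%:R^-1 :> R by rewrite lef_pV2 ?posrE// ler_nat.
  have := ler_distD z (T (u m)) (T (u n)); rewrite Tiso (distrC _ z) => h.
  have um := uP m; have un := uP n; have d0 := normr_ge0 (u m - u n).
  move: m0 m1 nm um un h d0; set a := m.+1%:R^-1; set b := n.+1%:R^-1.
  move=> m0 m1 nm um un h d0; have k : `|u m - u n| <= 2 * a by lra.
  by nra.
have [|l ul _] := cvg_of_rate _ rate; first by lra.
exists l; apply/esym/eqP; rewrite -subr_eq0 -normr_le0.
have cl : (fun=> `|z - T l|) @ \oo --> `|z - T l| by exact: cvg_cst.
have cr : (fun n => harmonic n + `|u n - l|) @ \oo --> (0 : R).
  rewrite -[X in _ --> X]addr0; apply: cvgD; first exact: cvg_harmonic.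
  rewrite -(@normr0 _ E) -(subrr l); apply: cvg_norm; apply: cvgB => //.
  exact: cvg_cst.
apply: ler_cvg_to cl cr _; apply: nearW => n /=.
apply: le_trans (ler_distD (T (u n)) _ _) _.
by rewrite Tiso lerD2r ltW// uP.
Qed.

(** Riesz's lemma: the direction from an almost nearest point of the range to a
    point outside it is almost at distance [1] from the range. *)
Lemma isometry_range_riesz (z : F) (d : R) :
  (forall x, T x <> z) -> 0 < d < 1 ->
  exists2 e : F, `|e| = 1 & forall x, 1 - d <= `|e - T x|.
Proof.
move=> zT /andP[d0 d1].
have [r r0 zr] : exists2 r, 0 < r & forall x, r <= `|z - T x|.
  have [//|/existsNP[r /not_implyP[r0 /forallNP zr]]] :=
    pselect (forall d, 0 < d -> exists x, `|z - T x| < d).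
    by move=> /isometry_range_closed [x /zT].
  by exists r => // x; rewrite leNgt; apply/negP/zr.
pose S := range (fun x => `|z - T x|).
have S0 : S !=set0 by exists `|z - T 0|, 0.
have lbS : lbound S r by move=> _ [x _ <-].
have D0 : 0 < inf S by apply: lt_le_trans r0 _; exact: lb_le_inf.
have Dx x : inf S <= `|z - T x|.
  by apply: ge_inf; [exists r | exists x].
have d1' : 0 < 1 - d by lra.
have /(inf_lt S0) [_ [x0 _ <-] x0D] : inf S < inf S / (1 - d).
  by rewrite ltr_pdivlMr//; nra.
rewrite ltr_pdivlMr// in x0D.
set p := `|z - T x0| in x0D *; have p0 : 0 < p by exact: lt_le_trans (Dx x0).
exists (p^-1 *: (z - T x0)).
  by rewrite normrZ ger0_norm ?invr_ge0 ?(ltW p0)// mulVf ?gt_eqF.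
move=> x.
have -> : p^-1 *: (z - T x0) - T x = p^-1 *: (z - T (x0 + p *: x)).
  rewrite linearD linearZ /= opprD addrA [in RHS]scalerBr scalerA.
  by rewrite mulVf ?gt_eqF// scale1r.
rewrite normrZ ger0_norm ?invr_ge0 ?(ltW p0)// ler_pdivlMl//.
by apply: le_trans (ltW x0D) _; exact: Dx.
Qed.

End Range.

Lemma edist_inf_lower_bound (R : realType) (F : normedModType R) (B : set F)
    (y : F) (c : R) :
  (forall b, B b -> c <= `|y - b|) -> (c%:E <= edist_inf B y)%E.
Proof.
move=> cB; apply: le_ereal_inf_tmp => _ [b Bb <-].
apply: le_ereal_inf_tmp => _ [r [r0 yb] <-]; rewrite lee_fin.
move: yb; rewrite -ball_normE /= => yb.
exact: le_trans (cB _ Bb) (ltW yb).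
Qed.

Lemma tau_lower_bound (R : realType) (F : normedModType R) (B : set F)
    (e : F) (c M : R) : `|e| = 1 -> 0 <= M ->
  (forall t b, M < `|t| -> B b -> c * `|t| <= `|t *: e - b|) ->
  (c%:E <= tau B)%E.
Proof.
move=> e1 M0 cB.
apply: le_trans (ereal_sup_ubound _); last by exists e.
rewrite limf_einfE; apply: le_trans (ereal_sup_ubound _); last first.
  by exists [set t | M < `|t|] => //; exists M.
apply: le_ereal_inf_tmp => _ [t /= tM <-].
have t0 : 0 < `|t| by exact: le_lt_trans tM.
rewrite inver gt_eqF// lee_pdivlMr// -EFinM; apply: edist_inf_lower_bound => b Bb.
exact: cB.
Qed.

(** The points [x] with [|x| <= 3 |t|] have [|f x - T x| <= d |t|], by the
    sublinear deviation and the size of [t]; for the others [|f x|] is already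
    so large that [f x] is at distance [|t|] from [t e]. *)
Lemma far_from_range (R : realType) (E F : normedModType R) (eps d : R)
    (f T : E -> F) (e : F) :
  0 <= eps -> 0 < d < 1 -> `|e| = 1 ->
  (forall x, `|x| - eps <= `|f x|) ->
  (forall x, `|f x - T x| ^+ 2 <= 8 * eps * (`|x| + eps)) ->
  (forall t x, (1 - d) * `|t| <= `|t *: e - T x|) ->
  forall t x, 32 * eps / d ^+ 2 < `|t| ->
    (1 - 2 * d) * `|t| <= `|t *: e - f x|.
Proof.
move=> eps0 /andP[d0 d1] e1 fn fT eT t x tM.
have d20 : 0 < d ^+ 2 by rewrite exprn_gt0.
have t0 : 0 < `|t| by apply: le_lt_trans tM; rewrite divr_ge0 ?mulr_ge0// ltW.
rewrite ltr_pdivrMr// in tM; set s := `|t| in t0 tM *.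
have et : 32 * eps <= s.
  by apply: ltW; apply: lt_le_trans tM _; rewrite ler_piMr ?exprn_ile1 ?ltW.
case: (lerP `|x| (3 * s)) => xs.
  have h : `|f x - T x| <= d * s.
    have ds0 : 0 <= d * s by rewrite mulr_ge0// ltW.
    rewrite -(ler_pXn2r (n := 2)) ?nnegrE//.
    apply: le_trans (fT x) _; rewrite exprMn.
    have ex : eps * (`|x| + eps) <= eps * (4 * s) by rewrite ler_wpM2l//; lra.
    have := ler_wpM2l (ltW t0) (ltW tM); lra.
  by have := ler_distD (f x) (t *: e) (T x); have := eT t x; rewrite -/s; lra.
have := lerB_dist (f x) (t *: e); rewrite normrZ e1 mulr1 -/s distrC.
have := fn x; nra.
Qed.

Lemma surjective_of_tau_lt1 (R : realType) (E : completeNormedModType R)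
    (F : normedModType R) (eps : R) (f : E -> F) (T : {linear E -> F}) :
  0 <= eps -> (forall x, `|x| - eps <= `|f x|) ->
  (forall x y, `|T x - T y| = `|x - y|) ->
  (forall x, `|f x - T x| ^+ 2 <= 8 * eps * (`|x| + eps)) ->
  (tau (range f) < 1)%E -> forall z, exists x, T x = z.
Proof.
move=> eps0 fn Tiso fT tau1 z; apply: contrapT => /forallNP zT.
have key d : 0 < d < 1 -> ((1 - 2 * d)%:E <= tau (range f))%E.
  move=> d01; have [e e1 eT] := isometry_range_riesz Tiso zT d01.
  have d20 : 0 <= d ^+ 2 by exact: sqr_ge0.
  apply: (tau_lower_bound (M := 32 * eps / d ^+ 2) e1).
    by rewrite divr_ge0// mulr_ge0.
  move=> t _ tM [x _ <-]; apply: far_from_range fT _ _ _ tM => // {x}t x.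
  have [->|t0] := eqVneq t 0; first by rewrite normr0 mulr0.
  have -> : t *: e - T x = t *: (e - T (t^-1 *: x)).
    by rewrite linearZ /= scalerBr scalerA mulfV// scale1r.
  by rewrite normrZ mulrC ler_pM2l ?normr_gt0.
move: tau1 key; case: (tau (range f)) => [c| |] //=.
  rewrite lte_fin => c1 key.
  (* A value of [d] in ]0, 1[ with [c < 1 - 2 d]. *)
  have [c0|c0] := leP c 0.
    have /key : 0 < (4^-1 : R) < 1 by apply/andP; split; lra.
    by rewrite lee_fin; lra.
  have /key : 0 < (1 - c) / 4 < 1 by apply/andP; split; lra.
  by rewrite lee_fin; lra.
move=> _ key; have /key : 0 < (4^-1 : R) < 1 by apply/andP; split; lra.
by rewrite leeNy_eq.
Qed.

Theorem mainTheorem5 (R : realType) (E F : completeNormedModType R)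
  (dot : {dot F for (@idfun R)}) (dotE : norm_from_dot dot)
  (E_neq0 : exists x : E, x != 0)
  (eps : R) (eps_ge0 : 0 <= eps)
  (f : E -> F) (f_near : nearisometry eps f) (f0 : f 0 = 0)
  (tau_lt1 : (tau (range f) < 1)%E) :
  exists T : {linear E -> F},
    [/\ forall x y : E, `|T x - T y| = `|x - y|,
        forall z : F, exists x : E, T x = z &
        (ereal_sup (range (fun x : E => `|T x - f x|%:E)) <= (2 * eps)%:E)%E].
Proof.
have [T [Tiso Tlim Trate]] := linear_rescaled_limit dotE eps_ge0 f_near f0.
have fn x : `|x| - eps <= `|f x| by have [] := near_norm f_near f0 x.
have Tsurj := surjective_of_tau_lt1 eps_ge0 fn Tiso Trate tau_lt1.
exists T; split=> //.
apply: ge_ereal_sup => _ [x _ <-]; rewrite lee_fin.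
exact: (deviation_of_surjective dotE).
Qed.
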